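(* Let $n\in \mathbb{N}$ with $n>1$. Then the solution $(F_n,r_x)$ is, up to isomorphism, the unique indecomposable involutive solution with abelian torsion-free permutation group and multipermutation level $n$.
   Context: $F_n$ is the (non-unital) subring of $\mathbb{Z}[x]/(x^{n+1})$ generated by $x$, so $F_n=\mathbb{Z}x\oplus\dots\oplus\mathbb{Z}x^n$. With its addition and $a\circ b=a+ab+b$ it is a brace, i.e. $(F_n,+)$ is an abelian group, $(F_n,\circ)$ is a group and $a\circ(b+c)=a\circ b-a+a\circ c$. Put $\lambda_a(b)=-a+a\circ b=b+ab$. The map $r_x:F_n^2\to F_n^2$ (with $F_n^2$ here the Cartesian square) is $r_x(a,b)=(\sigma_a(b),\sigma^{-1}_{\sigma_a(b)}(a))$ with $\sigma_a(b)=\lambda_a(x)\circ b$. A solution is a pair $(X,r)$ with $X$ a nonempty set and $r:X^2\to X^2$ a bijection, $r(x,y)=(\sigma_x(y),\tau_y(x))$, satisfying the braid equation $(r\times \mathrm{id})(\mathrm{id}\times r)(r\times \mathrm{id})=(\mathrm{id}\times r)(r\times \mathrm{id})(\mathrm{id}\times r)$ with all $\sigma_x,\tau_x$ bijective. It is involutive if $r^2=\mathrm{id}$; indecomposable if the group generated by all $\sigma_x,\tau_x$ is transitive on $X$; its permutation group is $\langle(\sigma_x,\tau_x^{-1})\mid x\in X\rangle\le\mathrm{Perm}(X)^2$. Isomorphisms $(X,r)\to(Y,s)$ are bijections $f$ with $(f\times f)r=s(f\times f)$. $\mathrm{Ret}(X,r)$ is the induced solution on $X/{\sim}$, where $x\sim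 y$ iff $\sigma_x=\sigma_y$ and $\tau_x=\tau_y$; the multipermutation level is the smallest $n\ge0$ such that the $n$-fold retraction $\mathrm{Ret}^n(X,r)$ has size $1$. *)

(* Defs.v *)
From HB Require Import structures.
From mathcomp Require Import all_boot all_order all_algebra.
From mathcomp Require Import ring boolp classical_sets.

Set Implicit Arguments.
Unset Strict Implicit.
Unset Printing Implicit Defensive.

Import GRing.Theory.
Local Open Scope quotient_scope.
Local Open Scope ring_scope.

Record Perm (X : Type) := MkPerm {
  perm_fun :> X -> X;
  perm_inv : X -> X;
  permK : cancel perm_fun perm_inv;
  permKV : cancel perm_inv perm_fun
}.

Lemma PermP (X : Type) (f g : Perm X) : f =1 g -> f = g.
Proof.
case: f g => [f f' fK f'K] [g g' gK g'K] /= fg.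
have {}fg : f = g by apply: funext.
subst g; have e : f' = g' by apply: funext => x; rewrite -{1}[x]g'K fK.
by subst g'; congr MkPerm; apply: Prop_irrelevance.
Qed.

Section PermGroup.
Variable X : Type.
Implicit Types f g : Perm X.

Definition Perm_one : Perm X := @MkPerm X id id (fun=> erefl) (fun=> erefl).
Definition Perm_opp f : Perm X := MkPerm (@permKV X f) (@permK X f).
(* composition: (f * g) x = f (g x) *)
Definition Perm_mul f g : Perm X :=
  MkPerm (can_comp (@permK X f) (@permK X g))
         (can_comp (@permKV X g) (@permKV X f)).

Fact Perm_mulA : associative Perm_mul. Proof. by move=> f g h; apply: PermP. Qed.
Fact Perm_mul1 : left_id Perm_one Perm_mul.
Proof. by move=> f; apply: PermP. Qed.
Fact Perm_mulr1 : right_id Perm_one Perm_mul.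
Proof. by move=> f; apply: PermP. Qed.
Fact Perm_mulV : left_inverse Perm_one Perm_opp Perm_mul.
Proof. by move=> f; apply: PermP => x /=; rewrite permK. Qed.
Fact Perm_mulrV : right_inverse Perm_one Perm_opp Perm_mul.
Proof. by move=> f; apply: PermP => x /=; rewrite permKV. Qed.

HB.instance Definition _ := gen_eqMixin (Perm X).
HB.instance Definition _ := gen_choiceMixin (Perm X).
HB.instance Definition _ := isGroup.Build (Perm X)
  Perm_mulA Perm_mul1 Perm_mulr1 Perm_mulV Perm_mulrV.
End PermGroup.

Definition gen_subgroup (G : groupType) (S : set G) : set G :=
  [set g | forall H : {pred G},
     group_closed H -> (forall s, S s -> s \in H) -> g \in H].

Definition abelian_subgroup (G : groupType) (A : set G) : Prop :=
  forall g h, A g -> A h -> commute g h.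

Definition torsion_free_subgroup (G : groupType) (A : set G) : Prop :=
  forall g k, A g -> (0 < k)%N -> (g ^+ k = 1)%g -> g = 1%g.

(* A set with a map X^2 -> X^2, not yet assumed to be a solution, so that the
   retraction below can be iterated without carrying proofs. *)
Record rset := RSet {
  rcarrier :> Type;
  rmap : rcarrier * rcarrier -> rcarrier * rcarrier
}.

Section Solutions.
Variable X : rset.

(* r (x, y) = (sigma x y, tau y x) *)
Definition sigma (x y : X) : X := (rmap (x, y)).1.
Definition tau (y x : X) : X := (rmap (x, y)).2.

Definition r_id (t : X * X * X) : X * X * X :=
  let: (x, y, z) := t in (sigma x y, tau y x, z).
Definition id_r (t : X * X * X) : X * X * X :=
  let: (x, y, z) := t in (x, sigma y z, tau z y).

Record is_solution : Prop := IsSolution {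
  sol_nonempty : inhabited X;
  sol_bij : bijective (@rmap X);
  sol_braid : r_id \o id_r \o r_id =1 id_r \o r_id \o id_r;
  sol_sigma_bij : forall x, bijective (sigma x);
  sol_tau_bij : forall x, bijective (tau x)
}.

Definition involutive_solution : Prop := @rmap X \o @rmap X =1 @id (X * X).

Definition indecomposable : Prop :=
  forall x y : X, exists2 g : Perm X,
    gen_subgroup [set h : Perm X | exists z, h =1 sigma z \/ h =1 tau z] g
    & g x = y.

Definition permutation_group : set (Perm X * Perm X)%type :=
  gen_subgroup
    [set g : Perm X * Perm X | exists x, g.1 =1 sigma x /\ (g.2^-1)%g =1 tau x].

Definition ret_rel : rel {classic X} :=
  fun x y => `[< sigma x = sigma y /\ tau x = tau y >].

Fact ret_rel_refl : reflexive ret_rel.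
Proof. by move=> x; apply/asboolP. Qed.
Fact ret_rel_sym : symmetric ret_rel.
Proof. by move=> x y; apply/asboolP/asboolP => -[-> ->]; split. Qed.
Fact ret_rel_trans : transitive ret_rel.
Proof.
move=> y x z /asboolP[sxy txy] /asboolP[syz tyz]; apply/asboolP.
by rewrite sxy txy.
Qed.

Canonical ret_equiv := EquivRel ret_rel ret_rel_refl ret_rel_sym ret_rel_trans.

Definition ret_class (x : X) : {eq_quot ret_equiv} := \pi_{eq_quot ret_equiv} x.

(* The induced map is computed on representatives; [Ret_class] below shows that
   for a solution it does not depend on them. *)
Definition Ret : rset :=
  @RSet {eq_quot ret_equiv} (fun u : {eq_quot ret_equiv} * {eq_quot ret_equiv} =>
    let v := @rmap X (repr u.1 : X, repr u.2 : X) in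
    (ret_class v.1, ret_class v.2)).

Lemma ret_classP (x y : X) :
  ret_class x = ret_class y <-> sigma x = sigma y /\ tau x = tau y.
Proof.
by split=> [/eqmodP/asboolP//|xy]; apply/eqmodP/asboolP.
Qed.

Lemma Ret_class : is_solution -> forall x y : X,
  @rmap Ret (ret_class x, ret_class y) =
  (ret_class (sigma x y), ret_class (tau y x)).
Proof.
move=> [_ _ braid sb tb] x y.
have S x1 x2 x3 :
    sigma (sigma x1 x2) (sigma (tau x2 x1) x3) = sigma x1 (sigma x2 x3).
  by case: (braid (x1, x2, x3)).
have T x1 x2 x3 :
    tau x3 (tau x2 x1) = tau (tau x3 x2) (tau (sigma x2 x3) x1).
  by case: (braid (x1, x2, x3)).
have repr_eq z : sigma (repr (ret_class z) : X) = sigma z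
              /\ tau (repr (ret_class z) : X) = tau z.
  by apply/ret_classP; rewrite {1}/ret_class reprK.
have [sx tx] := repr_eq x; have [sy ty] := repr_eq y.
rewrite /Ret /= -/(sigma _ _) -/(tau _ _).
move: (repr (ret_class x)) (repr (ret_class y)) sx tx sy ty.
move=> /= x' y' sx tx sy ty.
have sxy : sigma x' y' = sigma x y' by rewrite sx.
have txy : tau y' x' = tau y x' by rewrite ty.
congr (_, _); apply/ret_classP; rewrite -/(sigma x' y') -/(tau y' x').
  rewrite sxy; split; apply: funext => w.
    have [g _ gK] := sb (tau y x); rewrite -[w]gK S.
    by rewrite -{1}ty -{1}sy S sy.
  by apply: (bij_inj (tb (tau y x))); rewrite -T -{1 2}ty -T ty.
rewrite txy; split; apply: funext => w.
  by apply: (bij_inj (sb (sigma x y))); rewrite S -{1 2}sx S sx.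
have [g _ gK] := tb (sigma x y); rewrite -[w]gK -T.
by rewrite -{1}sx -{1}tx -T tx.
Qed.
End Solutions.

Arguments permutation_group : clear implicits.

Fixpoint Ret_iter (n : nat) (X : rset) : rset :=
  if n is m.+1 then Ret (Ret_iter m X) else X.

Definition size_one (X : rset) : Prop := exists x : X, forall y : X, y = x.

Definition multipermutation_level (X : rset) (n : nat) : Prop :=
  size_one (Ret_iter n X) /\ forall m, size_one (Ret_iter m X) -> (n <= m)%N.

Definition isomorphic (X Y : rset) : Prop :=
  exists2 f : X -> Y, bijective f
    & forall x y, rmap (f x, f y) =
                  (f (rmap (x, y)).1, f (rmap (x, y)).2).

Record indecomposable_abelian_tf (n : nat) (X : rset) : Prop := {
  iat_solution : is_solution X;
  iat_indecomposable : indecomposable X;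
  iat_involutive : involutive_solution X;
  iat_abelian : abelian_subgroup (permutation_group X);
  iat_torsion_free : torsion_free_subgroup (permutation_group X);
  iat_level : multipermutation_level X n
}.

Definition gen_nonunital_subring (R : pzRingType) (x : R) : set R :=
  [set a | forall H : {pred R},
     GRing.zmod_closed H -> GRing.mulr_2closed H -> x \in H -> a \in H].

Section Fn.
Variable n : nat.

(* {poly %/ p} is R[X]/(p) only for p monic and nonconstant, as is 'X^(n.+1) for
   every n. *)
Local Notation Q := {poly %/ ('X^(n.+1) : {poly int})}.

Definition in_Fn : {pred Q} :=
  fun a => `[< gen_nonunital_subring ('qX : Q) a >].

Fact in_Fn_zmod : zmod_closed in_Fn.
Proof.
split=> [|a b /asboolP Fa /asboolP Fb]; apply/asboolP => H H0 HM Hx.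
  by case: H0.
by case: (H0) => _; apply; [exact: Fa H H0 HM Hx | exact: Fb H H0 HM Hx].
Qed.
HB.instance Definition _ := GRing.isZmodClosed.Build Q in_Fn in_Fn_zmod.

Fact in_FnM : GRing.mulr_2closed in_Fn.
Proof.
move=> a b /asboolP Fa /asboolP Fb; apply/asboolP => H H0 HM Hx /=.
by apply: (HM); [exact: Fa H H0 HM Hx | exact: Fb H H0 HM Hx].
Qed.

Fact in_FnX : 'qX \in in_Fn.
Proof. by apply/asboolP. Qed.

Record Fn := MkFn { Fn_val :> Q; _ : Fn_val \in in_Fn }.
HB.instance Definition _ := [isSub for Fn_val].
HB.instance Definition _ := [Choice of Fn by <:].
HB.instance Definition _ := [SubChoice_isSubZmodule of Fn by <:].

Implicit Types a b c : Fn.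

Definition Fn_mul a b : Fn := MkFn (in_FnM (valP a) (valP b)).
Definition Fn_x : Fn := MkFn in_FnX.

Definition circ a b : Fn := a + Fn_mul a b + b.
Definition lambda a b : Fn := - a + circ a b.

(* The inverse of [a] for [circ] is -a + a^2 - ... + (-a)^n, by Horner. *)
Definition circ_inv a : Fn := iter n (fun c => - a - Fn_mul a c) 0.

Lemma Fn_inj : injective Fn_val. Proof. exact: val_inj. Qed.
Lemma Fn_valD a b : Fn_val (a + b) = Fn_val a + Fn_val b. Proof. by []. Qed.
Lemma Fn_valN a : Fn_val (- a) = - Fn_val a. Proof. by []. Qed.
Lemma Fn_val0 : Fn_val 0 = 0. Proof. by []. Qed.

Lemma circE a b : Fn_val (circ a b) = (1 + Fn_val a) * (1 + Fn_val b) - 1.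
Proof. by rewrite /circ !Fn_valD /=; ring. Qed.

Lemma circA : associative circ.
Proof. by move=> a b c; apply: Fn_inj; rewrite !circE; ring. Qed.
Lemma circC : commutative circ.
Proof. by move=> a b; apply: Fn_inj; rewrite !circE; ring. Qed.
Lemma circ0 : left_id 0 circ.
Proof. by move=> a; apply: Fn_inj; rewrite circE Fn_val0; ring. Qed.
Lemma circ_distr a b c : circ a (b + c) = circ a b - a + circ a c.
Proof.
apply: Fn_inj; rewrite Fn_valD Fn_valD Fn_valN !circE Fn_valD; ring.
Qed.

Lemma qXn0 : ('qX : Q) ^+ n.+1 = 0.
Proof.
rewrite -(rmorphXn (in_qpoly ('X^(n.+1) : {poly int}))) /=.
by apply: val_inj; rewrite /= mk_monic_Xn /= Pdiv.RingMonic.rmodpp ?monicXn.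
Qed.

Lemma Fn_nilp a : Fn_val a ^+ n.+1 = 0.
Proof.
have /asboolP Fa : Fn_val a \in in_Fn by exact: valP.
pose H : {pred Q} := fun y => `[< exists q, y = 'qX * q >].
have H0 : GRing.zmod_closed H.
  split=> [|y z /asboolP[p ->] /asboolP[q ->]]; apply/asboolP.
    by exists 0; rewrite mulr0.
  by exists (p - q); rewrite mulrBr.
have HM : GRing.mulr_2closed H.
  move=> y z /asboolP[p ->] _; apply/asboolP.
  by exists (p * z); rewrite mulrA.
have HX : 'qX \in H by apply/asboolP; exists 1; rewrite mulr1.
have /asboolP[q ->] := Fa H H0 HM HX.
by rewrite exprMn qXn0 mul0r.
Qed.

Lemma circ_invK : left_inverse 0 circ_inv circ.
Proof.
move=> a; rewrite circC; apply: Fn_inj; rewrite circE Fn_val0.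
have H k : (1 + Fn_val a) * (1 + Fn_val (iter k (fun c => - a - Fn_mul a c) 0))
           = 1 - (- Fn_val a) ^+ k.+1.
  elim: k => [|k IHk]; first by rewrite -[iter 0 _ _]/(0 : Fn) Fn_val0; ring.
  rewrite iterS Fn_valD !Fn_valN /=; move: IHk; set c := Fn_val (iter _ _ _).
  move=> IHk; have -> : 1 + (- Fn_val a - Fn_val a * c) = 1 - Fn_val a * (1 + c).
    by ring.
  rewrite mulrBr mulrCA IHk [(- Fn_val a) ^+ k.+2]exprS; ring.
by rewrite H exprNn Fn_nilp mulr0 subr0 subrr.
Qed.

Lemma lambdaE a b : lambda a b = b + Fn_mul a b.
Proof. by rewrite /lambda /circ -addrA addKr addrC. Qed.

Definition Fn_sigma a b : Fn := circ (lambda a Fn_x) b.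
Definition Fn_sigma_inv a b : Fn := circ (circ_inv (lambda a Fn_x)) b.

Lemma Fn_sigmaK a : cancel (Fn_sigma a) (Fn_sigma_inv a).
Proof. by move=> b; rewrite /Fn_sigma_inv circA circ_invK circ0. Qed.
Lemma Fn_sigma_invK a : cancel (Fn_sigma_inv a) (Fn_sigma a).
Proof.
by move=> b; rewrite /Fn_sigma circA (circC (lambda _ _)) circ_invK circ0.
Qed.

Definition Fn_solution : rset :=
  @RSet Fn (fun ab =>
    let: (a, b) := ab in (Fn_sigma a b, Fn_sigma_inv (Fn_sigma a b) a)).
End Fn.

(* Main.v *)
Require Import Defs.
From HB Require Import structures.
From mathcomp Require Import all_boot all_order all_algebra.
From mathcomp Require Import ssrAC zify ring boolp classical_sets.

Set Implicit Arguments.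
Unset Strict Implicit.
Unset Printing Implicit Defensive.

Import GRing.Theory.
Local Open Scope ring_scope.

(* Let [X] be a solution as in the statement. Its permutation group is abelian
   and transitive, hence regular, so [X] becomes an abelian group with
   [sigma a b = s a + b]. The braid equation says exactly that the maps
   [w |-> w + s (v - w)] commute; they are again transitive, hence yield a second
   abelian group law on [X], for which the first one is the circle operation
   [a + a b + b] of a commutative radical ring [R], and [s a = x + x a] with
   [R = Zx + xR]. The [k]-th retraction of [X] is the quotient of [R] by the
   annihilator of [x^k], so level [n] means [x^n R = 0] and [x^(n-1) R <> 0].
   Torsion-freeness makes [c x^n = 0] impossible for an integer [c <> 0], because
   [1 + x^n] would have finite order; hence [q |-> q(x) x] identifies [R] with
   [Z[t]/(t^n)], and [X] with the solution of [F_n]. *)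

(** * Regular actions of commuting families *)

Record abgroup (T : Type) := Abgroup {
  ab_zero : T;
  ab_opp : T -> T;
  ab_add : T -> T -> T;
  ab_addA : associative ab_add;
  ab_addC : commutative ab_add;
  ab_add0 : left_id ab_zero ab_add;
  ab_addN : left_inverse ab_zero ab_opp ab_add
}.

(** The alias records [G], so that one type can carry several group laws: below, two additions
    coexist on the same carrier. *)
Definition zmod_of (T : Type) (G : abgroup T) : Type := T.
HB.instance Definition _ T (G : abgroup T) := gen_eqMixin (zmod_of G).
HB.instance Definition _ T (G : abgroup T) := gen_choiceMixin (zmod_of G).
HB.instance Definition _ T (G : abgroup T) := GRing.isZmodule.Build (zmod_of G)
  (@ab_addA T G) (@ab_addC T G) (@ab_add0 T G) (@ab_addN T G).

(* Transitivity of the group generated by the maps [P i], from the point [o]. *)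
Definition reachable (T I : Type) (P : I -> T -> T) (o : T) : Prop :=
  forall K : T -> Prop, K o -> (forall i t, K t <-> K (P i t)) -> forall t, K t.

(* The centralizer of a transitive commuting family acts regularly, and the
   bijection [g |-> g o] transports its group law to [T]. *)
Lemma regular_abelian (T I : Type) (P : I -> T -> T) (o : T) :
  (forall i, bijective (P i)) -> (forall i j t, P i (P j t) = P j (P i t)) ->
  reachable P o ->
  exists G : abgroup T, ab_zero G = o /\
    forall g : T -> T, (forall i t, g (P i t) = P i (g t)) ->
    forall t, g t = ab_add G (g o) t.
Proof.
move=> Pbij PC Preach.
have PV i : exists Q, cancel (P i) Q /\ cancel Q (P i).
  by case: (Pbij i) => Q; exists Q.
pose central (g : T -> T) := forall i t, g (P i t) = P i (g t).
have central_eq g h : central g -> central h -> g o = h o -> forall t, g t = h t.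
  move=> gP hP gh; apply: Preach => // i t; rewrite gP hP.
  split=> [->//|]; exact: bij_inj.
(* [m x] is the unique central map that sends [o] to [x]. Composition of central maps becomes the
   group law [m] on [T]. *)
have [m mP] : {m : T -> T -> T | forall x, central (m x) /\ m x o = x}.
  suff H : forall x, exists g, central g /\ g o = x.
    by exists (fun x => projT1 (cid (H x))) => x; case: cid.
  apply: Preach => [|i t]; first by exists id.
  split=> -[g [gP go]].
    by exists (P i \o g); split=> [j u|] /=; rewrite (gP, go) // PC.
  have [Q [PQ QP]] := PV i.
  exists (Q \o g); split=> [j u|] /=; last by rewrite go.
  by apply: (bij_inj (Pbij i)); rewrite PC !QP gP.
have mc x : central (m x) by case: (mP x).
have mo x : m x o = x by case: (mP x).
have mE g : central g -> forall t, g t = m (g o) t.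
  by move=> gP; apply: central_eq; rewrite ?mo.
have mA : associative m.
  move=> x y z; have /= -> := mE (m x \o m y) _ z; first by rewrite mo.
  by move=> i t /=; rewrite !mc.
have mC : commutative m.
  move=> x; apply: Preach => [|i y]; first by rewrite mo -(mE id) // => i t.
  have mPi : m (P i y) x = P i (m y x).
    have /= -> := mE (P i \o m y) _ x; first by rewrite mo.
    by move=> j t /=; rewrite mc; exact: PC.
  by rewrite mPi mc; split=> [->//|/(bij_inj (Pbij i))].
have m1 : left_id o m by move=> x; rewrite mC mo.
have [n nP] : {n : T -> T | left_inverse o n m}.
  suff H : forall x, exists y, m y x = o.
    by exists (fun x => projT1 (cid (H x))) => x; case: cid.
  apply: Preach => [|i t]; first by exists o; rewrite mo.
  have [Q [PQ QP]] := PV i.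
  have mPi y : m (P i y) t = m y (P i t) by rewrite mC mc mC -mc.
  by split=> -[y yP]; [exists (Q y); rewrite -mPi QP | exists (P i y); rewrite mPi].
by exists (Abgroup mA mC m1 nP); split=> // g gP t; apply: mE.
Qed.

(** * Commutative radical rings and their retractions *)

Record radical_ring := RadicalRing {
  rr_sort :> zmodType;
  rr_mul : rr_sort -> rr_sort -> rr_sort;
  rr_inv : rr_sort -> rr_sort;
  rr_mulC : commutative rr_mul;
  rr_mulA : associative rr_mul;
  rr_mulDr : right_distributive rr_mul +%R;
  rr_invP : forall a, a + rr_mul a (rr_inv a) + rr_inv a = 0
}.

Section RadicalRing.
Variable R : radical_ring.
Implicit Types a b c u x : R.
Local Notation "a ** b" := (rr_mul a b) (at level 40, left associativity).

Definition rr_circ a b : R := a + a ** b + b.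
Local Notation "a @@ b" := (rr_circ a b) (at level 50, left associativity).

Lemma rr_mul0 a : a ** 0 = 0.
Proof. by apply: (addrI (a ** 0)); rewrite -rr_mulDr !addr0. Qed.

Lemma rr_mulN a b : a ** - b = - (a ** b).
Proof. by apply: (addrI (a ** b)); rewrite -rr_mulDr !subrr rr_mul0. Qed.

Lemma rr_mulB a b c : a ** (b - c) = a ** b - a ** c.
Proof. by rewrite rr_mulDr rr_mulN. Qed.

Lemma rr_mulDl a b c : (b + c) ** a = b ** a + c ** a.
Proof. by rewrite -!(rr_mulC a) rr_mulDr. Qed.

Lemma rr_mulCA a b c : a ** (b ** c) = b ** (a ** c).
Proof. by rewrite !rr_mulA (rr_mulC a). Qed.

Lemma rr_circC : commutative rr_circ.
Proof. by move=> a b; rewrite /rr_circ rr_mulC addrC [a + _]addrC addrA. Qed.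

Lemma rr_circA : associative rr_circ.
Proof.
move=> a b c; rewrite /rr_circ !rr_mulDr !rr_mulDl rr_mulA !addrA.
by rewrite [LHS](ACl (1*2*5*4*3*6*7)).
Qed.

Lemma rr_circ0 : left_id 0 rr_circ.
Proof. by move=> a; rewrite /rr_circ rr_mulC rr_mul0 !add0r. Qed.

Lemma rr_circV : left_inverse 0 (@rr_inv R) rr_circ.
Proof. by move=> a; rewrite rr_circC; apply: rr_invP. Qed.

Definition circ_group : abgroup R := Abgroup rr_circA rr_circC rr_circ0 rr_circV.

Section Powers.
Variable x : R.
Local Notation xpow k := (iter k (rr_mul x)).

Lemma xpow0 k : xpow k 0 = 0 :> R.
Proof. by elim: k => //= k ->; rewrite rr_mul0. Qed.

Lemma xpowD k a b : xpow k (a + b) = xpow k a + xpow k b.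
Proof. by elim: k => //= k ->; rewrite rr_mulDr. Qed.

Lemma xpowM k u a : xpow k (u ** a) = u ** xpow k a.
Proof. by elim: k => //= k ->; rewrite rr_mulCA. Qed.

Lemma xpow_circ k a a' b b' : xpow k a = xpow k a' -> xpow k b = xpow k b' ->
  xpow k (a @@ b) = xpow k (a' @@ b').
Proof.
move=> aa' bb'; rewrite /rr_circ !xpowD aa' bb'; congr (_ + _ + _).
by rewrite xpowM bb' -xpowM rr_mulC xpowM aa' -xpowM rr_mulC.
Qed.

(** Both inverses have the shape [rr_inv b @@ c @@ rr_inv a], with [c = b] for the first and [c = a]
    for the second, so [xpow_circ] compares them. *)
Lemma xpow_inv k a b : xpow k a = xpow k b -> xpow k (rr_inv a) = xpow k (rr_inv b).
Proof.
move=> ab; have ea : rr_inv a = rr_inv b @@ b @@ rr_inv a.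
  by rewrite rr_circV rr_circ0.
have eb : rr_inv b = rr_inv b @@ a @@ rr_inv a.
  by rewrite -rr_circA (rr_circC a) rr_circV rr_circC rr_circ0.
by rewrite [in LHS]ea [in RHS]eb; apply: (xpow_circ (xpow_circ _ _)).
Qed.

(** Formally [x (1 + a)]; in the brace of [R] this is the element written lambda_a(x). *)
Definition cocycle a : R := x + x ** a.
Definition ring_sigma a b : R := cocycle a @@ b.
Definition ring_tau b a : R := rr_inv (cocycle (ring_sigma a b)) @@ a.

(** Involutivity determines [ring_tau] from [ring_sigma]; this form lets later proofs avoid circle
    inverses. *)
Lemma ring_tauP a b c : ring_sigma (ring_sigma a b) c = a <-> c = ring_tau b a.
Proof.
rewrite /ring_tau [ring_sigma _ c]/ring_sigma; split=> [{2}<-|->].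
  by rewrite rr_circA rr_circV rr_circ0.
by rewrite rr_circA (rr_circC (cocycle _)) rr_circV rr_circ0.
Qed.

(* [f] presents [Y] as the quotient of the solution of [R] by the annihilator
   of the [k]-th power of [x]. *)
Record presents (k : nat) (Y : rset) (f : R -> Y) : Prop := Presents {
  presents_surj : forall y, exists a, f a = y;
  presents_eq : forall a b, f a = f b <-> xpow k a = xpow k b;
  presents_rmap : forall a b,
    rmap (f a, f b) = (f (ring_sigma a b), f (ring_tau b a))
}.

(** The factor [x] in front of [a] in the cocycle is what makes each retraction raise the exponent
    by one. *)
Lemma xpow_cocycle k a b :
  xpow k.+1 a = xpow k.+1 b <-> xpow k (cocycle a) = xpow k (cocycle b).
Proof.
rewrite !xpowD !xpowM /=; split=> [->//|]; exact: addrI.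
Qed.

Lemma xpow_succ k a b : xpow k a = xpow k b -> xpow k.+1 a = xpow k.+1 b.
Proof. by rewrite /= => ->. Qed.

Lemma xpow_sigma k a a' b b' : xpow k a = xpow k a' -> xpow k b = xpow k b' ->
  xpow k (ring_sigma a b) = xpow k (ring_sigma a' b').
Proof. by move=> /xpow_succ/xpow_cocycle aa' bb'; apply: xpow_circ. Qed.

Lemma xpow_tau k a a' b b' : xpow k a = xpow k a' -> xpow k b = xpow k b' ->
  xpow k (ring_tau b a) = xpow k (ring_tau b' a').
Proof.
move=> aa' bb'; apply: xpow_circ => //; apply/xpow_inv/xpow_cocycle/xpow_succ.
exact: xpow_sigma.
Qed.

(** Two maps [sigma] agree exactly when the cocycles agree modulo the annihilator of [x^k], and
    [xpow_cocycle] shifts this to [x^(k+1)]; the maps [tau] then agree as well. *)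
Lemma presents_Ret k (Y : rset) (f : R -> Y) :
  presents k f -> presents k.+1 (fun a => ret_class (f a) : Ret Y).
Proof.
move=> [fsurj feq frmap].
have retE a b : ret_class (f a) = ret_class (f b) <-> xpow k.+1 a = xpow k.+1 b.
  rewrite ret_classP; split=> [[+ _]|ab].
    (* Since 0 is neutral for the circle operation, evaluating at [f 0] leaves the bare cocycles. *)
    move=> /(congr1 (fun h => h (f 0))); rewrite /sigma !frmap /= feq.
    by rewrite /ring_sigma ![_ @@ 0]rr_circC !rr_circ0 -xpow_cocycle.
  split; apply: funext => y; have [c <-] := fsurj y.
    rewrite /sigma !frmap /= feq; apply: xpow_circ => //.
    exact/xpow_cocycle.
  rewrite /tau !frmap /= feq; apply: xpow_circ => //; apply/xpow_inv/xpow_cocycle.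
  exact: xpow_sigma.
split=> [y|//|a b].
  by have [a fa] := fsurj (repr y); exists a; rewrite fa /ret_class reprK.
(* [Ret] computes on representatives, which match the given elements only modulo the annihilator of
   [x^(k+1)]. *)
have reprE c : exists2 c', repr (ret_class (f c)) = f c' & xpow k.+1 c' = xpow k.+1 c.
  have [c' fc'] := fsurj (repr (ret_class (f c))); exists c' => //.
  by apply/retE; rewrite fc' /ret_class reprK.
rewrite /Ret /=; have [a' ea aa'] := reprE a; have [b' eb bb'] := reprE b.
by rewrite ea eb frmap /=; congr (_, _); apply/retE; [exact: xpow_sigma | exact: xpow_tau].
Qed.

Lemma size_one_Ret_iter (Y : rset) (f : R -> Y) k : presents 0 f ->
  size_one (Ret_iter k Y) <-> forall a, xpow k a = 0.
Proof.
move=> f0; have [g [gsurj geq _]] : exists g : R -> Ret_iter k Y, presents k g.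
  elim: k => [|k [g gP]]; first by exists f.
  by exists (fun a => ret_class (g a)); apply: presents_Ret.
split=> [[y yP] a|x0].
  by rewrite -(xpow0 k); apply/geq; rewrite (yP (g a)) (yP (g 0)).
by exists (g 0) => y; have [a ya] := gsurj y; rewrite -ya; apply/geq; rewrite !x0.
Qed.

End Powers.
End RadicalRing.

(** * Polynomial evaluation and truncated rings *)

Section PolyEval.
Variables (R : radical_ring) (x : R).
Implicit Types (q r : {poly int}) (a b : R).
Local Notation "a ** b" := (rr_mul a b) (at level 40, left associativity).
Local Notation xpow k := (iter k (rr_mul x)).

(* This is [q(x) x]: the factor [x] makes up for the missing unit of [R]. *)
Definition poly_eval q : R := \sum_(i < size q) xpow i x *~ q`_i.

Lemma poly_evalE N q : (size q <= N)%N ->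
  poly_eval q = \sum_(i < N) xpow i x *~ q`_i.
Proof.
move=> qN; rewrite /poly_eval (big_ord_widen N (fun i => xpow i x *~ q`_i)) //.
rewrite big_mkcond; apply: eq_bigr => i _; case: ltnP => // /(nth_default 0) ->.
by rewrite mulr0z.
Qed.

Lemma poly_evalB q r : poly_eval (q - r) = poly_eval q - poly_eval r.
Proof.
pose N := maxn (size q) (size r).
have qN : (size q <= N)%N by exact: leq_maxl.
have rN : (size r <= N)%N by exact: leq_maxr.
have qrN : (size (q - r)%R <= N)%N.
  by rewrite (leq_trans (size_polyD _ _)) // size_polyN.
rewrite (poly_evalE qN) (poly_evalE rN) (poly_evalE qrN) -sumrB.
by apply: eq_bigr => i _; rewrite coefB mulrzBr.
Qed.
HB.instance Definition _ :=
  GRing.isZmodMorphism.Build {poly int} R poly_eval poly_evalB.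

Lemma rr_mulMz a b (c : int) : a ** (b *~ c) = (a ** b) *~ c.
Proof.
case: c => m; rewrite ?NegzE ?mulrNz -?pmulrn ?rr_mulN; first last.
  by congr (- _); elim: m.+1 => [|k IHk]; rewrite ?rr_mul0 // !mulrS rr_mulDr IHk.
by elim: m => [|k IHk]; rewrite ?rr_mul0 // !mulrS rr_mulDr IHk.
Qed.

Lemma rr_mul_sum I (s : seq I) (F : I -> R) a :
  a ** (\sum_(i <- s) F i) = \sum_(i <- s) a ** F i.
Proof.
elim: s => [|i s IHs]; first by rewrite !big_nil rr_mul0.
by rewrite !big_cons rr_mulDr IHs.
Qed.

Lemma poly_eval_cons q (c : int) :
  poly_eval (q * 'X + c%:P) = x *~ c + x ** poly_eval q.
Proof.
rewrite (@poly_evalE (size q).+1); last first.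
  rewrite (leq_trans (size_polyD _ _)) // geq_max (leq_trans (size_polyC_leq1 _)) //.
  by rewrite andbT (leq_trans (size_polyMleq _ _)) // size_polyX addn2.
rewrite big_ord_recl /= coefD coefMX coefC /= add0r rr_mul_sum; congr (_ + _).
by apply: eq_bigr => i _; rewrite coefD coefMX coefC /= addr0 rr_mulMz.
Qed.

Lemma poly_evalX q : poly_eval (q * 'X) = x ** poly_eval q.
Proof. by have := poly_eval_cons q 0; rewrite addr0 mulr0z add0r. Qed.

Lemma poly_eval1 : poly_eval 1 = x.
Proof.
have := poly_eval_cons 0 1.
by rewrite mul0r add0r raddf0 rr_mul0 addr0.
Qed.

Lemma poly_evalZ (c : int) q : poly_eval (c *: q) = poly_eval q *~ c.
Proof. by rewrite -[c in LHS]intz scaler_int raddfMz. Qed.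

(** Each of the two values carries its own factor [x], while [poly_eval] supplies only one: hence
    the extra ['X]. *)
Lemma poly_evalM q r : poly_eval q ** poly_eval r = poly_eval (q * r * 'X).
Proof.
elim/poly_ind: q => [|q c IHq].
  by rewrite !mul0r raddf0 rr_mulC rr_mul0.
rewrite poly_eval_cons rr_mulDl -rr_mulA IHq rr_mulC rr_mulMz.
rewrite mulrDl mulrDl raddfD /= addrC; congr (_ + _).
  by rewrite -poly_evalX; congr poly_eval; ring.
by rewrite -mulrA mul_polyC poly_evalZ poly_evalX rr_mulC.
Qed.

Lemma poly_eval_cocycle q : cocycle x (poly_eval q) = poly_eval (1 + q * 'X).
Proof. by rewrite raddfD /= poly_eval1 poly_evalX. Qed.

Lemma poly_eval_sigma q r :
  ring_sigma x (poly_eval q) (poly_eval r) =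
  poly_eval (1 + q * 'X + (1 + q * 'X) * r * 'X + r).
Proof. by rewrite /ring_sigma poly_eval_cocycle /rr_circ poly_evalM !raddfD. Qed.

(* The properties that determine [(R, x)], up to isomorphism, as the
   ideal generated by [x] in Z[x]/(x^(n+1)). *)
Record truncated (n : nat) : Prop := Truncated {
  trunc_gen : forall a, exists (c : int) b, a = x *~ c + x ** b;
  trunc_nil : forall a, xpow n a = 0;
  trunc_level : ~ forall a, xpow n.-1 a = 0;
  trunc_tf : forall a m, (0 < m)%N -> iter m (rr_circ a) 0 = 0 -> a = 0
}.

Lemma poly_eval_surj n a : truncated n -> exists q, poly_eval q = a.
Proof.
move=> [gen nil _ _].
(* Unfolding [trunc_gen] [k] times pushes the remainder into [x^k R], which is zero for [k = n]. *)
have H k b : exists q c, b = poly_eval q + xpow k c.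
  elim: k b => [|k IHk] b; first by exists 0, b; rewrite raddf0 add0r.
  have [c [b' ->]] := gen b; have [q [d ->]] := IHk b'.
  by exists (q * 'X + c%:P), d; rewrite poly_eval_cons rr_mulDr addrA.
by have [q [c ->]] := H n a; exists q; rewrite nil addr0.
Qed.

Lemma xpowMz k a (c : int) : xpow k (a *~ c) = xpow k a *~ c.
Proof. by elim: k => //= k ->; rewrite rr_mulMz. Qed.

Lemma xpow_sum k I (s : seq I) (F : I -> R) :
  xpow k (\sum_(i <- s) F i) = \sum_(i <- s) xpow k (F i).
Proof.
elim: s => [|i s IHs]; first by rewrite !big_nil xpow0.
by rewrite !big_cons xpowD IHs.
Qed.

(** The element [y] is the [n]-th power of [x]. It is nonzero, since otherwise [trunc_gen] would
    give [x^(n-1) R = 0]. As [y] squares to zero, its circle powers are its additive multiples, so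
    [trunc_tf] excludes additive torsion. *)
Lemma truncated_torsion n (c : int) :
  (0 < n)%N -> truncated n -> xpow n.-1 x *~ c = 0 -> c = 0.
Proof.
move=> n0 [gen nil lev tf]; set y := xpow n.-1 x => yc.
have y0 : y <> 0.
  move=> y0; apply: lev => a; have [d [b ->]] := gen a.
  by rewrite xpowD xpowMz -/y y0 mul0rz -iterSr prednK // nil addr0.
have yy : y ** y = 0.
  by rewrite {2}/y -xpowM rr_mulC -iterSr prednK // nil.
have yM m : iter m (rr_circ y) 0 = y *+ m.
  elim: m => //= m ->; rewrite /rr_circ mulrS pmulrn rr_mulMz yy mul0rz addr0.
  by rewrite -pmulrn.
have [/eqP|c0] := eqVneq c 0; first by move/eqP.
case: y0; apply: (tf y `|c|%N); first by rewrite absz_gt0.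
rewrite yM; case: c yc {c0} => m; first by rewrite -pmulrn.
by rewrite NegzE mulrNz -pmulrn => /eqP; rewrite oppr_eq0 => /eqP.
Qed.

(** By induction on [i]: multiplication by [x^(n-1-i)] kills the terms above [i], those below vanish
    by induction, and [q_i x^n = 0] remains. *)
Lemma poly_eval_eq0 n q : (0 < n)%N -> truncated n ->
  poly_eval q = 0 <-> forall i, (i < n)%N -> q`_i = 0.
Proof.
move=> n0 tr; have [_ nil _ _] := tr.
have big0 k a : (n <= k)%N -> xpow k a = 0.
  by move=> nk; rewrite -(subnKC nk) iterD nil.
rewrite /poly_eval; split=> [q0 | q0]; last first.
  apply: big1 => i _; have [/q0 ->|/big0 ->] := ltnP i n; first exact: mulr0z.
  exact: mul0rz.
elim/ltn_ind => i IHi lin; apply: (truncated_torsion n0 tr).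
have [qi|iq] := leqP (size q) i; first by rewrite nth_default ?mulr0z.
have := congr1 (iter (n.-1 - i) (rr_mul x)) q0.
rewrite xpow_sum xpow0 (bigD1 (Ordinal iq)) //= big1 => [|j /eqP ji].
  rewrite addr0 xpowMz -iterD subnK //; by rewrite -ltnS prednK.
rewrite xpowMz; have [ltji|leij] := ltnP j i.
  by rewrite IHi ?mulr0z // (ltn_trans ltji).
rewrite -iterD big0 ?mul0rz //; have : i != j :> nat.
  by apply/eqP => ij; apply: ji; apply: val_inj.
by move: lin leij n0; clear; lia.
Qed.
End PolyEval.

(** By [poly_eval_eq0] the kernel of evaluation depends on [n] only, so sending the value of a
    polynomial in [R] to its value in [R'] is a well-defined bijection. *)
Lemma truncated_isomorphic n (R R' : radical_ring) (x : R) (x' : R') (Y Y' : rset)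
    (f : R -> Y) (f' : R' -> Y') :
  (0 < n)%N -> truncated x n -> truncated x' n ->
  presents x 0 f -> presents x' 0 f' -> isomorphic Y Y'.
Proof.
move=> n0 tR tR' [fsurj feq frmap] [fsurj' feq' frmap'].
have ker q r : f (poly_eval x q) = f (poly_eval x r) <->
               f' (poly_eval x' q) = f' (poly_eval x' r).
  have eq0 := poly_eval_eq0 (q - r) n0.
  rewrite feq feq' /=; split=> /eqP; rewrite -subr_eq0 -raddfB /= => /eqP.
    by move=> /(eq0 _ _ tR)/(eq0 _ _ tR') /eqP; rewrite raddfB subr_eq0 => /eqP.
  by move=> /(eq0 _ _ tR')/(eq0 _ _ tR) /eqP; rewrite raddfB subr_eq0 => /eqP.
have surj y : exists q, f (poly_eval x q) = y.
  have [a <-] := fsurj y; have [q <-] := poly_eval_surj a tR; by exists q.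
have surj' y : exists q, f' (poly_eval x' q) = y.
  have [a <-] := fsurj' y; have [q <-] := poly_eval_surj a tR'; by exists q.
pose h y := f' (poly_eval x' (projT1 (cid (surj y)))).
pose h' y := f (poly_eval x (projT1 (cid (surj' y)))).
have hE q : h (f (poly_eval x q)) = f' (poly_eval x' q).
  by rewrite /h; case: cid => r /= /ker.
have h'E q : h' (f' (poly_eval x' q)) = f (poly_eval x q).
  by rewrite /h'; case: cid => r /= /ker.
exists h; first exists h'; first by move=> y; have [q <-] := surj y; rewrite hE h'E.
  by move=> y; have [q <-] := surj' y; rewrite h'E hE.
move=> y z; have [q <-] := surj y; have [r <-] := surj z.
rewrite !hE frmap frmap' /=.
(* [ring_tau] involves an inverse and has no evident polynomial formula. A polynomial [t] is chosen
   for its value, and [ring_tauP] reduces the claim to [ring_sigma]. *)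
have [t tE] := poly_eval_surj (ring_tau x (poly_eval x r) (poly_eval x q)) tR.
rewrite -tE poly_eval_sigma !hE; congr (_, _); first by rewrite poly_eval_sigma.
congr f'; apply/esym/ring_tauP; rewrite !poly_eval_sigma.
apply/(feq' _ _)/ker/feq; rewrite -!poly_eval_sigma; exact/ring_tauP.
Qed.

(** * Involutive solutions from a cocycle on an abelian group *)

Section CocycleSolution.
Variables (A : zmodType) (s : A -> A).
Hypothesis cyc : forall a b, s a + s (b - s a) = s b + s (a - s b).

(** The second component is the one that involutivity forces: applying [sigma (s a + b)] to it
    returns [a]. *)
Definition cocycle_solution : rset :=
  @RSet A (fun ab => (s ab.1 + ab.2, ab.1 - s (s ab.1 + ab.2))).
Local Notation Y := cocycle_solution.

Lemma cocycle_sigma_tau a b :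
  s (s a + b) + s (a - s (s a + b)) = s a + s b.
Proof. by rewrite -cyc addrAC subrr add0r. Qed.

Lemma cocycle_involutive : involutive_solution Y.
Proof.
by case=> a b /=; rewrite [s (s a + b) + _]addrC subrK addrAC subrr add0r.
Qed.

Lemma cocycle_braid : r_id (X := Y) \o id_r (X := Y) \o r_id (X := Y) =1
  id_r (X := Y) \o r_id (X := Y) \o id_r (X := Y).
Proof.
move=> [[a b] c]; rewrite /= /sigma /tau /=.
set b' := s a + b; set d := s b + c; set F := s a + d; set t := a - s b'.
have st : s t = s a + s b - s b'.
  by rewrite -(cocycle_sigma_tau a b) -/b' -/t [RHS]addrC addKr.
have E : s t + c = F - s b' by rewrite st /F /d addrA [LHS]addrAC.
have sp : s (a - s F) = s a - s F + s d.
  by have /(canRL (addKr _)) -> := esym (cyc a F);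
     rewrite {2}/F addrC [s a + d]addrC addrK addrAC.
have bF : s (a - s F) + (b - s d) = b' - s F.
  by rewrite sp addrA addrAC addrK addrAC.
rewrite E bF [s b' + _]addrC subrK; congr (_, _, _).
(* What remains is [a - s b' - s (F - s b') = a - s F - s (b' - s F)], an instance of [cyc]. *)
by rewrite /t -[LHS]addrA -[RHS]addrA -!opprD cyc.
Qed.

Hypothesis s_bij : bijective (fun a => a - s a).

(** Conjugation by the bijection [a |-> a - s a] turns [tau b] into the translation by [- s b]. *)
Lemma cocycle_tau_bij (b : Y) : bijective (tau b).
Proof.
have TE a : tau b a - s (tau b a) = a - s a - s b :> A.
  by rewrite /tau /= -!addrA -!opprD; congr (_ - _); rewrite cocycle_sigma_tau.
have [D TD DT] := s_bij.
exists (fun a => D ((a - s a) + s b)) => a.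
  by rewrite TE subrK TD.
by apply: (bij_inj s_bij); rewrite TE DT addrK.
Qed.

Lemma cocycle_is_solution : is_solution Y.
Proof.
split.
- exact: inhabits (0 : A).
- exists (@rmap Y); exact: cocycle_involutive.
- exact: cocycle_braid.
- by move=> a; exists (fun b => - s a + b) => b; rewrite /sigma /= ?addKr ?addNKr.
- exact: cocycle_tau_bij.
Qed.
End CocycleSolution.

(** * Generated subgroups and powers of permutations *)

Section GeneratedSubgroup.
Variables (G : groupType) (S : set G).

Lemma gen_subgroup1 : gen_subgroup S 1%g.
Proof. by move=> H [H1 _]. Qed.

Lemma gen_subgroupV g : gen_subgroup S g -> gen_subgroup S (g^-1)%g.
Proof. by move=> gS H HG HS; apply: (group_closedV HG); apply: gS. Qed.

Lemma gen_subgroupM g h :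
  gen_subgroup S g -> gen_subgroup S h -> gen_subgroup S (g * h)%g.
Proof.
move=> gS hS H HG HS; apply: (group_closedM HG); [exact: gS | exact: hS].
Qed.

Lemma gen_subgroupX g k : gen_subgroup S g -> gen_subgroup S (g ^+ k)%g.
Proof.
move=> gS; elim: k => [|k IHk]; first exact: gen_subgroup1.
rewrite expgS; exact: gen_subgroupM.
Qed.

Lemma mem_gen_subgroup g : S g -> gen_subgroup S g.
Proof. by move=> Sg H _; apply. Qed.

Lemma gen_subgroup_ind (P : G -> Prop) : P 1%g ->
  (forall g h, P g -> P h -> P (g * h)%g) -> (forall g, P g -> P (g^-1)%g) ->
  (forall g, S g -> P g) -> forall g, gen_subgroup S g -> P g.
Proof.
move=> P1 PM PV PS g gS; apply/asboolP.
apply: (gS (fun h => `[< P h >])) => [|h Sh]; last by apply/asboolP/PS.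
split=> [|h k /asboolP Ph /asboolP Pk]; apply/asboolP => //.
by apply: PM => //; apply: PV.
Qed.
End GeneratedSubgroup.

Lemma Perm_expE (X : Type) (g : Perm X) k y : (g ^+ k)%g y = iter k g y.
Proof. by elim: k y => // k IHk y; rewrite expgS /= -IHk. Qed.

Lemma pair_expE (X : Type) (g : Perm X * Perm X) k : (g ^+ k)%g.1 = (g.1 ^+ k)%g.
Proof. by elim: k => // k IHk; rewrite !expgS /= IHk. Qed.

Lemma bijective_Perm (X : Type) (f : X -> X) :
  bijective f -> exists g : Perm X, g =1 f.
Proof. by case=> f' fK f'K; exists (MkPerm fK f'K). Qed.

(** * Permutation groups of involutive solutions *)

Section Involutive.
Variable X : rset.
Hypothesis sol : is_solution X.
Hypothesis inv : involutive_solution X.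
Implicit Types x y z : X.
Local Notation PG := (permutation_group X).

Let sigma_inj x : injective (sigma x).
Proof. exact: bij_inj (sol_sigma_bij sol x). Qed.

Let tau_inj x : injective (tau x).
Proof. exact: bij_inj (sol_tau_bij sol x). Qed.

Lemma sigma_sigma_tau x y : sigma (sigma x y) (tau y x) = x.
Proof.
have := inv (x, y); rewrite /= /sigma /tau => /(congr1 fst) /=.
by case: (rmap (x, y)).
Qed.

Lemma tau_sigma_tau x y : tau (tau y x) (sigma x y) = y.
Proof.
have := inv (x, y); rewrite /= /sigma /tau => /(congr1 snd) /=.
by case: (rmap (x, y)).
Qed.

Lemma sigma_braid x y z :
  sigma (sigma x y) (sigma (tau y x) z) = sigma x (sigma y z).
Proof. by case: (sol_braid sol (x, y, z)). Qed.

(** Involutivity turns [sigma x z = x] into [tau z x = z], and [tau z] is injective. *)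
Lemma diagonal_inj x y z : sigma x z = x -> sigma y z = y -> x = y.
Proof.
have H u : sigma u z = u -> tau z u = z.
  by move=> uz; apply: (@sigma_inj u); rewrite uz -[u in sigma u]uz sigma_sigma_tau.
by move=> /H xz /H yz; apply: (@tau_inj z); rewrite xz.
Qed.

Lemma diagonal_surj z : exists x, sigma x z = x.
Proof.
have [t _ tK] := sol_tau_bij sol z; exists (t z).
have := sigma_sigma_tau (t z) z; have := tau_sigma_tau (t z) z.
by rewrite tK => E _; apply: (@tau_inj z); rewrite tK.
Qed.

(* The two components of [g] are conjugate under [x |-> sigma x ^-1 x]. *)
Lemma permutation_group_diagonal g x z :
  PG g -> sigma x z = x <-> sigma (g.2 x) (g.1 z) = g.2 x.
Proof.
move=> gP; move: g gP x z; apply: gen_subgroup_ind => [//|g h gP hP x z|g gP x z|].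
- by rewrite hP gP.
- by rewrite -(permKV g.1 z) -(permKV g.2 x) -gP /= !permKV.
move=> g [y [g1 g2]] x z.
set x' := g.2 x; have xE : tau y x' = x by rewrite -g2 /= permK.
have := sigma_sigma_tau x' y; rewrite g1 -sigma_braid xE => x'E.
by split=> [->//|E]; apply: (@sigma_inj (sigma x' y)); rewrite E x'E.
Qed.

(** The diagonal relation makes the first component determine the second, so commutation and torsion
    can be tested on first components. *)
Lemma permutation_group_fst1 g : PG g -> g.1 =1 id -> g = 1%g.
Proof.
move=> gP g1; case: g gP g1 => g h gP /= g1; congr (_, _); apply: PermP => //= x.
have [s _ sK] := sol_sigma_bij sol x.
have /(permutation_group_diagonal _ _ gP) /= := sK x.
by rewrite g1 => hx; apply: diagonal_inj hx (sK x).
Qed.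

Lemma permutation_group_abelian :
  (forall g h, PG g -> PG h -> forall x, g.1 (h.1 x) = h.1 (g.1 x)) ->
  abelian_subgroup PG.
Proof.
move=> comm g h gP hP; apply/(mulIg (h * g)^-1%g); rewrite mulgV.
apply: permutation_group_fst1 => [|x].
  by apply: gen_subgroupM; [|apply: gen_subgroupV]; apply: gen_subgroupM.
by rewrite /= comm // !permKV.
Qed.

Lemma permutation_group_torsion_free :
  (forall g k, PG g -> (0 < k)%N -> (forall x, iter k g.1 x = x) -> g.1 =1 id) ->
  torsion_free_subgroup PG.
Proof.
move=> tf g k gP k0 gk; apply: permutation_group_fst1 => //; apply: (tf g k) => //.
by move=> x; rewrite -Perm_expE -pair_expE gk.
Qed.

Lemma permutation_group_sigma x : exists2 g, PG g & g.1 =1 sigma x.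
Proof.
have [g gE] := bijective_Perm (sol_sigma_bij sol x).
have [h hE] := bijective_Perm (sol_tau_bij sol x).
exists (g, h^-1%g) => //; apply: mem_gen_subgroup; exists x; by split.
Qed.

Lemma indecomposable_reachable o : indecomposable X -> reachable (@sigma X) o.
Proof.
move=> ind K Ko KS x; have [g gP <-] := ind o x.
suff : forall y, K y <-> K (g y) by move=> <-.
move: g gP; apply: gen_subgroup_ind => [//|g h gP hP y|g gP y|g [z gz] y].
- by rewrite hP gP.
- by rewrite (gP (g^-1%g y)) /= permKV.
case: gz => ->; first exact: KS.
(* [sigma (sigma y z)] sends [tau z y] back to [y], so stability under all [sigma] gives stability
   under all [tau]. *)
by rewrite [K (tau z y)](KS (sigma y z)) sigma_sigma_tau.
Qed.

Lemma reachable_indecomposable o : reachable (@sigma X) o -> indecomposable X.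
Proof.
move=> ro; suff H x : exists2 g : Perm X,
    gen_subgroup [set h : Perm X | exists z, h =1 sigma z \/ h =1 tau z] g & g o = x.
  move=> x y; have [g gP <-] := H x; have [h hP <-] := H y.
  exists (h * g^-1)%g; last by rewrite /= permK.
  by apply: gen_subgroupM => //; apply: gen_subgroupV.
move: x; apply: ro => [|z t]; first by exists 1%g => //; exact: gen_subgroup1.
have [s sE] := bijective_Perm (sol_sigma_bij sol z).
have sP : gen_subgroup [set h : Perm X | exists z, h =1 sigma z \/ h =1 tau z] s.
  by apply: mem_gen_subgroup; exists z; left.
split=> -[g gP go].
  by exists (s * g)%g; [exact: gen_subgroupM | rewrite /= go sE].
exists (s^-1 * g)%g; first by apply: gen_subgroupM => //; apply: gen_subgroupV.
by rewrite /= go -sE permK.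
Qed.
End Involutive.

(** * Radical rings from braces and from cocycles *)

Section Brace.
Variables (V : zmodType) (circ : V -> V -> V) (i : V -> V).
Hypotheses (circA : associative circ) (circC : commutative circ).
Hypothesis circV : forall a, circ a (i a) = 0.
Hypothesis circDr : forall a b c, circ a (b + c) + a = circ a b + circ a c.

Let mul a b := circ a b - a - b.

Let circE a b : circ a b = a + mul a b + b.
Proof. by rewrite /mul -[a + _ + b]addrA subrK addrC subrK. Qed.

Let mulC : commutative mul.
Proof. by move=> a b; rewrite /mul circC addrAC. Qed.

Let mulDr : right_distributive mul +%R.
Proof.
move=> a b c; rewrite /mul opprD.
have -> : circ a (b + c) = circ a b + circ a c - a by rewrite -circDr addrK.
by rewrite !addrA [RHS](ACl (1*4*2*5*3*6)).
Qed.

(** Associativity of [circ], expanded by distributivity, is associativity of [mul] plus terms common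
    to both sides. *)
Let mulA : associative mul.
Proof.
move: mul mulC mulDr circE => m mC mDr cE.
have mDl a b c : m (a + b) c = m a c + m b c by rewrite mC mDr !(mC c).
move=> a b c; have := circA a b c; rewrite !cE !mDr !mDl !addrA.
by rewrite [LHS](ACl (1*2*4*5*6*7*3)) [RHS](ACl (1*2*4*3*6*7*5)) /= => /addrI.
Qed.

Let mulV a : a + mul a (i a) + i a = 0.
Proof. by rewrite -circE circV. Qed.

Definition brace_ring : radical_ring := RadicalRing mulC mulA mulDr mulV.

Lemma brace_ring_circE (a b : brace_ring) : rr_circ a b = circ a b.
Proof. by rewrite /rr_circ -circE. Qed.
End Brace.

(** Stability of [Zx + xR] under the transitive translations, from which it follows that it is all
    of [R]. *)
Lemma cocycle_gen (R : radical_ring) (x w t : R) :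
  (exists (c : int) b, t = x *~ c + rr_mul x b) <->
  (exists (c : int) b, cocycle x w + t = x *~ c + rr_mul x b).
Proof.
rewrite /cocycle; split=> -[c [b E]].
  exists (c + 1), (w + b); rewrite E mulrzDr mulr1z rr_mulDr !addrA.
  by rewrite [LHS](ACl (3*1*2*4)).
exists (c - 1), (b - w); apply: (addrI (x + rr_mul x w)).
rewrite [LHS]E mulrzBr mulr1z rr_mulB !addrA.
by rewrite [RHS](ACl (3*5*(1*4)*(2*6))) /= !subrr !addr0.
Qed.

(* The maps [w |-> w + s (v - w)] commute and are transitive; in the ring they
   are the additive translations by [x + x v]. *)
Lemma cocycle_radical_ring (A : zmodType) (s : A -> A) :
  (forall a b, s a + s (b - s a) = s b + s (a - s b)) ->
  bijective (fun a => a - s a) -> reachable (fun v t => s v + t) 0 ->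
  exists (R : radical_ring) (f : R -> A) (x : R),
    [/\ bijective f, f 0 = 0, forall a b, f (rr_circ a b) = f a + f b,
        forall a, f (cocycle x a) = s (f a)
      & forall a, exists (c : int) b, a = x *~ c + rr_mul x b].
Proof.
move=> cyc sbij sreach.
pose P v w := w + s (v - w).
have PC u v w : P u (P v w) = P v (P u w).
  by rewrite /P !opprD !addrA -![w + _ + _]addrA cyc.
have Pbij v : bijective (P v).
  have [D TD DT] := sbij.
  exists (fun w => v - D (v - w)) => w; first by rewrite /P opprD addrA TD subKr.
  by rewrite /P subKr -addrA -opprB [- D _ + _]addrC opprB -[s _ - _]opprB DT subKr.
have [G [G0 GP]] : exists G : abgroup A, ab_zero G = 0 /\
    forall g, (forall v t, g (P v t) = P v (g t)) ->
    forall t, g t = ab_add G (g 0) t.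
  apply: regular_abelian => // K K0 KP; apply: sreach => // v t.
  (* [P (v + t) t] equals [s v + t], so transitivity passes from the translations by [s v] to the
     maps [P]. *)
  by rewrite (KP (v + t)) /P addrK addrC.
pose V : zmodType := zmod_of G.
have PE v t : P v t = (s v : V) + (t : V) :> V.
  by rewrite (GP (P v)) // /P subr0 add0r.
(* The old addition of [A] becomes the circle operation over the new addition of [V]; the two share
   their zero. *)
pose circ (a b : V) : V := (a : A) + (b : A).
have V0 : (0 : V) = (0 : A) by exact: G0.
have circr0 a : circ a 0 = a by rewrite /circ V0 addr0.
(* Translation by [a] in [A] conjugates [P u] into [P (a + u)]. *)
have circP (a u t : A) : circ a ((s u : V) + t) = (s (a + u) : V) + circ a t.
  by rewrite -!PE /circ /P addrA; congr (_ + s _); rewrite [a + u]addrC opprD addrA addrK.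
have stepE v t : (s v + t : A) = (s (v + t) : V) + (t : V) :> V.
  by rewrite -PE /P addrK addrC.
have circDr (a b c : V) : circ a (b + c) + a = circ a b + circ a c.
  (* Induction along the transitive action: a step changes [b] by a value of [s] in [V], and [circP]
     changes both sides by the same summand. *)
  move: b; apply: sreach => [|v t].
    by rewrite -V0 add0r circr0 addrC.
  rewrite stepE -addrA !circP -!addrA.
  by split=> [->//|/addrI].
have circA : associative circ by exact: (@addrA A).
have circC : commutative circ by exact: (@addrC A).
have circV a : circ a (- (a : A)) = 0 by rewrite /circ subrr -V0.
pose R := brace_ring circA circC circV circDr; pose x : R := s 0.
have cocycleE (a : R) : cocycle x a = s a.
  apply: (addIr a); rewrite -[LHS]/(rr_circ x a) brace_ring_circE circC.
  by have := circP a 0 (0 : V); rewrite !addr0 circr0.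
exists R, id, x; split=> //.
- by exists id.
- by move=> a b; rewrite brace_ring_circE.
apply: sreach => [|v t].
  by exists 0, 0; rewrite mulr0z rr_mul0 add0r.
rewrite stepE -[(s (v + t) : V)]cocycleE; exact: (@cocycle_gen R).
Qed.

(** * The truncated ring of a given solution *)

Lemma iter_rr_circ (R : radical_ring) (a b : R) m :
  iter m (rr_circ a) b = rr_circ (iter m (rr_circ a) 0) b.
Proof. by elim: m => [|m IHm] /=; rewrite ?rr_circ0 // IHm rr_circA. Qed.

Lemma solution_truncated_ring n (X : rset) : (0 < n)%N ->
  indecomposable_abelian_tf n X ->
  exists (R : radical_ring) (x : R) (f : R -> X), truncated x n /\ presents x 0 f.
Proof.
move=> n0 [sol ind inv ab tf [levn levmin]].
have [o] := sol_nonempty sol.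
have reach := indecomposable_reachable inv (o := o) ind.
have comm g z t : permutation_group X g -> g.1 (sigma z t) = sigma z (g.1 t).
  move=> gP; have [h hP hE] := permutation_group_sigma sol z; rewrite -!hE.
  by have /(congr1 (fun k : Perm X * Perm X => k.1 t)) := ab g h gP hP.
have scomm (y z t : X) : sigma y (sigma z t) = sigma z (sigma y t).
  by have [g gP gE] := permutation_group_sigma sol y; rewrite -!gE comm.
have [G [G0 GP]] := regular_abelian (sol_sigma_bij sol) scomm reach.
pose A : zmodType := zmod_of G; pose s (a : A) : A := sigma (a : X) o.
have A0 : (0 : A) = o by exact: G0.
have sE (a t : A) : sigma (a : X) t = s a + t.
  by apply: (GP (sigma (a : X))) => z u; apply: scomm.
(* The braid equation at the triple [a], [b - s a], 0, where [sigma a] sends the second entry to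
   [b]. *)
have cyc (a b : A) : s a + s (b - s a) = s b + s (a - s b).
  have ab' : sigma (a : X) (b - s a) = b by rewrite sE addrC subrK.
  have ta : tau (b - s a : X) (a : X) = a - s b.
    have := sigma_sigma_tau inv (a : X) (b - s a : A); rewrite ab' sE => E.
    by apply: (addrI (s b)); rewrite E addrC subrK.
  have := sigma_braid sol a (b - s a) (0 : A); rewrite ab' ta !sE !addr0.
  by move=> ->.
(* [a - s a = z] means [sigma a z = a], so this is the bijectivity of the diagonal. *)
have sbij : bijective (fun a => a - s a).
  have D z : exists a, a - s a = z.
    have [a az] := diagonal_surj sol inv z; exists a.
    by apply: (addrI (s a)); rewrite addrC subrK -sE az.
  have inj a b : a - s a = b - s b -> a = b.
    move=> ab'; apply: (diagonal_inj sol inv (z := a - s a)).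
      by rewrite sE addrC subrK.
    by rewrite ab' sE addrC subrK.
  exists (fun z => projT1 (cid (D z))) => z; case: cid => //= a; exact: inj.
have sreach : reachable (fun v t => s v + t) 0.
  move=> K K0 KP; apply: reach => [|v t]; first by rewrite -A0.
  by rewrite (sE v t).
have [R [f [x [fbij f0 fM fs gen]]]] := cocycle_radical_ring cyc sbij sreach.
exists R, x, f.
have fsig a b : sigma (f a : X) (f b) = f (ring_sigma x a b).
  by rewrite sE fM fs.
have pres : presents x 0 (f : R -> X).
  split=> [y|a b|a b].
  - by have [g _ gK] := fbij; exists (g y).
  - by split=> [/(bij_inj fbij)|/= ->].
  rewrite -fsig [LHS]surjective_pairing; congr (_, _).
  apply: (bij_inj (sol_sigma_bij sol (sigma (f a : X) (f b)))).
  rewrite -/(tau (f b : X) (f a)) (sigma_sigma_tau inv) !fsig.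
  by congr f; apply/esym/ring_tauP.
split=> //; split=> //.
- by apply/(size_one_Ret_iter n pres).
- by move=> /(size_one_Ret_iter n.-1 pres)/levmin; rewrite -ltnS prednK // ltnn.
move=> a m m0 am.
(* By transitivity some [g] sends [o] to [f a], and by regularity its first component is the circle
   translation by [a]; finite circle order of [a] becomes torsion of [g]. *)
have [g gP go] : exists2 g, permutation_group X g & g.1 o = f a.
  move: (f a); apply: reach => [|z t].
    by exists 1%g => //; exact: gen_subgroup1.
  have [h hP hE] := permutation_group_sigma sol z.
  split=> -[g gP go].
    by exists (h * g)%g; [exact: gen_subgroupM | rewrite /= go hE].
  exists (h^-1 * g)%g; first by apply: gen_subgroupM => //; apply: gen_subgroupV.
  by rewrite /= go -hE permK.
have gE b : g.1 (f b) = f (rr_circ a b).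
  by rewrite fM -go; apply: (GP g.1) => z t; apply: comm.
have gm : (g ^+ m = 1)%g.
  apply: (permutation_group_fst1 sol inv) => [|t]; first exact: gen_subgroupX.
  have [b <-] := presents_surj pres t.
  have -> : (g ^+ m)%g.1 (f b) = f (iter m (rr_circ a) b).
    by rewrite pair_expE Perm_expE; elim: m {m0 am} => //= m ->; exact: gE.
  by rewrite iter_rr_circ am rr_circ0.
have g1 := tf g m gP m0 gm.
by apply: (bij_inj fbij); rewrite -go g1 f0.
Qed.

(** * The solution attached to a radical ring *)

Section RingSolution.
Variables (R : radical_ring) (x : R).
Local Notation "a ** b" := (rr_mul a b) (at level 40, left associativity).
Local Notation "a @@ b" := (rr_circ a b) (at level 50, left associativity).
Local Notation A := (zmod_of (circ_group R)).

(** With a formal unit, [(1 + c)(1 + x (1 + d)) = 1 + c + x (1 + c)(1 + d)]. *)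
Lemma circ_cocycle (c d : R) : c @@ cocycle x d = c + x + x ** (c @@ d).
Proof.
rewrite /cocycle /rr_circ !rr_mulDr !addrA (rr_mulC c x) (rr_mulCA c x).
by rewrite [LHS](ACl (1*4*2*3*5)).
Qed.

Let s (a : A) : A := cocycle x (a : R).

(** Addition in [A] is the circle operation of [R]. By [circ_cocycle] either side is the ring sum
    [x + x a + x + x b], symmetric in [a] and [b]. *)
Lemma ring_cocycleE (a b : A) : s a + s (b - s a) = s b + s (a - s b).
Proof.
have E c d : s c + s (d - s c) = (x + x ** c + x + x ** d)%R.
  rewrite -[LHS]/(s c @@ cocycle x (d - s c : A)) circ_cocycle.
  rewrite -[s c @@ _]/(s c + (d - s c) : A) [in X in _ ** X]addrC subrK.
  by [].
by rewrite !E [LHS](ACl (3*4*1*2)).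
Qed.

(** Up to circle inversion, [a |-> a - s a] is the ring translation by [x], hence bijective. *)
Lemma ring_cocycle_inv (a : A) : rr_inv (a - s a : A) = rr_inv a + x :> R.
Proof.
rewrite -[LHS]/(- (a - s a) : A) opprB addrC -[LHS]/(rr_inv a @@ cocycle x a).
by rewrite circ_cocycle rr_circV rr_mul0 addr0.
Qed.

Lemma ring_cocycle_bij : bijective (fun a : A => a - s a).
Proof.
have invK (a : R) : rr_inv (rr_inv a) = a by exact: (@opprK A).
exists (fun w : A => rr_inv (rr_inv (w : R) - x)%R : A) => w.
  by rewrite ring_cocycle_inv addrK invK.
by rewrite -[LHS]invK ring_cocycle_inv invK subrK invK.
Qed.

Definition ring_solution : rset := cocycle_solution s.
Local Notation Y := ring_solution.

Lemma ring_solution_sol : is_solution Y.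
Proof. exact: cocycle_is_solution ring_cocycleE ring_cocycle_bij. Qed.

Lemma ring_solution_inv : involutive_solution Y.
Proof. exact: cocycle_involutive. Qed.

Lemma ring_solution_presents : presents x 0 (id : R -> Y).
Proof.
split=> [y|//|a b]; first by exists y.
rewrite /= /ring_tau rr_circC; congr (_, _).
Qed.

Lemma ring_solution_reachable :
  (forall a : R, exists (c : int) b, a = x *~ c + x ** b) ->
  reachable (@sigma Y) (0 : R).
Proof.
move=> gen K K0 KP.
(* The index [rr_inv t @@ u] is chosen so that [circ_cocycle] cancels [t]: the step adds exactly
   [x + x u]. *)
have Kadd (u t : R) : K t <-> K (t + x + x ** u : R).
  have <- : rr_circ (cocycle x (rr_inv t @@ u)) t = t + x + x ** u.
    by rewrite (rr_circC _ t) circ_cocycle rr_circA (rr_circC t) rr_circV rr_circ0.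
  exact: KP.
have Kx c : K (x *~ c : R).
  have step (t : R) : K t <-> K (t + x : R) by rewrite (Kadd 0) rr_mul0 addr0.
  elim/int_ind: c => [//|m IHm|m IHm]; first by rewrite -addn1 PoszD mulrzDr mulr1z -step.
  by rewrite step -addn1 PoszD opprD mulrzDr mulrN1z subrK.
(* Starting from [c - 1] leaves room for the copy of [x] that comes along with [x b]. *)
move=> a; have [c [b ->]] := gen a.
have := Kx (c - 1); rewrite (Kadd b) mulrzBr mulr1z subrK.
by [].
Qed.

Lemma ring_solution_fst g : permutation_group Y g ->
  exists u : R, forall y : R, g.1 y = u @@ y.
Proof.
move: g; apply: gen_subgroup_ind => [|g h [u gu] [v hv]|g [u gu]|g [u [g1 _]]].
- by exists 0 => y; rewrite rr_circ0.
- by exists (u @@ v) => y; rewrite /= hv gu rr_circA.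
- exists (rr_inv u) => y; apply: (can_inj (permK g.1)).
  by rewrite [LHS](permKV g.1) gu rr_circA (rr_circC u) rr_circV rr_circ0.
by exists (cocycle x u) => y; rewrite g1.
Qed.

Lemma truncated_ring_solution n : (0 < n)%N -> truncated x n ->
  indecomposable_abelian_tf n Y.
Proof.
move=> n0 [gen nil lev tf].
have sol := ring_solution_sol; have inv := ring_solution_inv.
split=> //.
- exact: (reachable_indecomposable sol (ring_solution_reachable gen)).
- apply: permutation_group_abelian => // g h /ring_solution_fst[u gu].
  by move=> /ring_solution_fst[v hv] y; rewrite !(gu, hv) !rr_circA (rr_circC u).
- apply: permutation_group_torsion_free => // g k /ring_solution_fst[u gu] k0 gk y.
  rewrite gu (tf u k k0) ?rr_circ0 //; rewrite -[RHS](gk (0 : R)).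
  by elim: (k) => //= m ->; rewrite gu.
split; first by apply/(size_one_Ret_iter n ring_solution_presents).
move=> m /(size_one_Ret_iter m ring_solution_presents) xm.
rewrite leqNgt; apply/negP => mn; apply: lev => a.
by rewrite -(@subnK m n.-1) ?iterD ?xm ?xpow0 // -ltnS prednK.
Qed.
End RingSolution.

(** * The ring [F_n] is truncated *)

Lemma unipotent_torsion_free (C : comNzRingType) (u : C) n m :
  (forall (y : C) k, (0 < k)%N -> y *+ k = 0 -> y = 0) ->
  u ^+ n.+1 = 0 -> (0 < m)%N -> (1 + u) ^+ m = 1 -> u = 0.
Proof.
move=> tf un m0 um1.
have [c cE] : exists c, (1 + u) ^+ m = 1 + u *+ m + u ^+ 2 * c.
  elim: (m) => [|k [c IHk]]; first by exists 0; rewrite mulr0 addr0 mulr0n addr0.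
  by exists (c + u * c + k%:R); rewrite exprS IHk mulrS -mulr_natr; ring.
have um : u *+ m = - (u ^+ 2 * c).
  by move: cE; rewrite um1 -addrA => /esym/(canRL (addKr _)); rewrite addNr => /eqP;
     rewrite addr_eq0 => /eqP.
(* Each further factor [m] gains a factor [u], because [m u] lies in the ideal of [u^2]. At [k = n]
   the power of [u] vanishes, and additive torsion-freeness concludes. *)
have H k : exists d, u *+ m ^ k = u ^+ k.+1 * d.
  elim: k => [|k [d IHk]]; first by exists 1; rewrite mulr1.
  exists (- c * d); rewrite expnSr mulrnA IHk.
  transitivity (u ^+ k * d * (u *+ m)); last by rewrite um !exprS; ring.
  by rewrite -mulr_natr -[u *+ m]mulr_natr exprS; ring.
have [d dE] := H n; apply: (tf u (m ^ n)%N); first by rewrite expn_gt0 m0.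
by rewrite dE un mul0r.
Qed.

Section FnRing.
Variable n : nat.
Local Notation Q := {poly %/ ('X^(n.+1) : {poly int})}.
Local Notation x := (Fn_x n).
Implicit Types a b : Fn n.

Fact Fn_mulC : commutative (@Fn_mul n).
Proof. by move=> a b; apply: Fn_inj; rewrite /= mulrC. Qed.

Fact Fn_mulA : associative (@Fn_mul n).
Proof. by move=> a b c; apply: Fn_inj; rewrite /= mulrA. Qed.

Fact Fn_mulDr : right_distributive (@Fn_mul n) +%R.
Proof. by move=> a b c; apply: Fn_inj; rewrite Fn_valD /= mulrDr. Qed.

Fact Fn_circ_invP a : circ a (circ_inv a) = 0.
Proof. by rewrite circC circ_invK. Qed.

Definition Fn_ring : radical_ring :=
  RadicalRing Fn_mulC Fn_mulA Fn_mulDr Fn_circ_invP.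

(** An equality, not only an isomorphism: [lambda a x] is the cocycle [x + x a]. *)
Lemma Fn_solutionE : Fn_solution n = ring_solution (x : Fn_ring).
Proof.
have sE a b : Fn_sigma a b = rr_circ (cocycle (x : Fn_ring) a) (b : Fn_ring).
  by rewrite /Fn_sigma lambdaE Fn_mulC.
rewrite /Fn_solution /ring_solution /cocycle_solution; congr RSet.
apply: funext => -[a b].
rewrite [RHS](presents_rmap (ring_solution_presents (x : Fn_ring))).
by rewrite /Fn_sigma_inv sE lambdaE Fn_mulC.
Qed.

Lemma Fn_valM a b : Fn_val (Fn_mul a b) = Fn_val a * Fn_val b.
Proof. by []. Qed.

Lemma Fn_val_mulrz a (c : int) : Fn_val (a *~ c) = Fn_val a *~ c.
Proof.
have E m : Fn_val (a *+ m) = Fn_val a *+ m.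
  by elim: m => // m IHm; rewrite !mulrS Fn_valD IHm.
by case: c => m; rewrite ?NegzE ?mulrNz ?Fn_valN -!pmulrn E.
Qed.

Lemma Fn_gen a : exists (c : int) b, a = x *~ c + Fn_mul x b.
Proof.
pose H : {pred Q} := fun y => `[< exists (c : int) (b : Fn n), y = 'qX *~ c + 'qX * Fn_val b >].
have H0 : GRing.zmod_closed H.
  split=> [|y z /asboolP[c [b ->]] /asboolP[d [e ->]]]; apply/asboolP.
    by exists 0, 0; rewrite mulr0z Fn_val0 mulr0 addr0.
  by exists (c - d), (b - e); rewrite Fn_valD Fn_valN mulrzBr; ring.
have HX : 'qX \in H.
  by apply/asboolP; exists 1, 0; rewrite mulr1z Fn_val0 mulr0 addr0.
have HM : GRing.mulr_2closed H.
  move=> y z /asboolP[c [b ->]] /asboolP[d [e ->]]; apply/asboolP.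
  (* Lifting the first factor to [w] in [F_n] shows the product to be [x (d w + w e)], with no
     integer multiple of [x]. *)
  have [w wE] : exists w : Fn n, Fn_val w = 'qX *~ c + 'qX * Fn_val b.
    by exists (x *~ c + Fn_mul x b); rewrite Fn_valD Fn_val_mulrz Fn_valM.
  exists 0, (w *~ d + Fn_mul w e).
  rewrite -wE mulr0z add0r Fn_valD Fn_val_mulrz Fn_valM; ring.
have /asboolP Fa : Fn_val a \in @in_Fn n by exact: valP.
have /asboolP[c [b E]] := Fa H H0 HM HX.
by exists c, b; apply: Fn_inj; rewrite Fn_valD Fn_val_mulrz Fn_valM.
Qed.

Lemma Fn_xpow k a : Fn_val (iter k (Fn_mul x) a) = 'qX ^+ k * Fn_val a.
Proof. by elim: k => [|k IHk] /=; rewrite ?mul1r // IHk (exprS ('qX : Q) k) mulrA. Qed.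

Lemma qpoly_torsion_free (y : Q) m : (0 < m)%N -> y *+ m = 0 -> y = 0.
Proof.
move=> m0 ym; apply: val_inj; apply/polyP => i.
have /(congr1 (fun p : {poly int} => p`_i)) := congr1 val ym.
rewrite raddfMn /= coefMn coef0 => /eqP; rewrite Num.Theory.mulrn_eq0.
by rewrite eqn0Ngt m0 => /eqP.
Qed.

Lemma qXn_neq0 : ('qX : Q) ^+ n != 0.
Proof.
rewrite -(rmorphXn (in_qpoly ('X^(n.+1) : {poly int}))) /=.
apply/eqP => /(congr1 val) /=; rewrite -[X in X = _]/(in_qpoly _ _ : {poly int}).
rewrite in_qpoly_small ?mk_monic_Xn ?size_polyXn //.
by apply/eqP; rewrite -size_poly_gt0 size_polyXn.
Qed.

(** Adding 1 turns circle powers into powers of the unipotent element [1 + a]. *)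
Lemma Fn_circ_torsion_free a m : (0 < m)%N ->
  iter m (rr_circ (a : Fn_ring)) 0 = 0 -> a = 0.
Proof.
move=> m0 am; apply: Fn_inj; rewrite Fn_val0.
apply: (unipotent_torsion_free qpoly_torsion_free (Fn_nilp a) m0).
have E k : 1 + Fn_val (iter k (rr_circ (a : Fn_ring)) 0 : Fn n) = (1 + Fn_val a) ^+ k.
  elim: k => [|k IHk]; first by rewrite Fn_val0 addr0.
  rewrite iterS -[rr_circ _ _]/(circ a (iter k (rr_circ (a : Fn_ring)) 0)).
  by rewrite circE addrC subrK IHk (exprS (1 + Fn_val a) k).
by rewrite -E am Fn_val0 addr0.
Qed.

Lemma Fn_truncated : (0 < n)%N -> truncated (x : Fn_ring) n.
Proof.
move=> n0; split.
- exact: Fn_gen.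
- move=> a; have [c [b ->]] := Fn_gen a; apply: Fn_inj.
  rewrite Fn_xpow Fn_valD Fn_val_mulrz /= mulrDr mulrzAr mulrA -(exprSr ('qX : Q) n) qXn0.
  by rewrite mul0rz mul0r addr0.
(* The witness is [x] itself: [x^(n-1) x] is ['qX ^+ n], the last nonzero power. *)
- move=> /(_ x)/(congr1 (@Fn_val n)); rewrite Fn_xpow Fn_val0 /= -(exprSr ('qX : Q) n.-1) prednK //.
  by apply/eqP; exact: qXn_neq0.
- exact: Fn_circ_torsion_free.
Qed.
End FnRing.

Theorem theorem8p4 (n : nat) (hn : (1 < n)%N) :
  indecomposable_abelian_tf n (Fn_solution n) /\
  (forall X : rset, indecomposable_abelian_tf n X ->
     isomorphic X (Fn_solution n)).
Proof.
have n0 : (0 < n)%N by exact: ltnW.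
have tr := Fn_truncated n0; rewrite Fn_solutionE; split.
  exact: truncated_ring_solution.
move=> X /(solution_truncated_ring n0)[R [x [f [xtr fP]]]].
exact: truncated_isomorphic n0 xtr tr fP (ring_solution_presents _).
Qed.
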